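(* Let $B$ be a finite connected left regular band and $\Bbbk$ a field. For each $X\in\Lambda(B)$ fix $e_X\in B$ with $Be_X=X$, and let $L_Y=\{b\in B\mid Bb=Y\}$. Then for $X,Y\in\Lambda(B)$ the Cartan invariant of $\Bbbk B$ is $$C_{X,Y}=\sum_{Z\le X}|e_ZB\cap L_Y|\cdot\mu(Z,X),$$ where $\mu$ is the Möbius function of $\Lambda(B)$. Moreover $C_{X,Y}=0$ unless $X\ge Y$, and $C_{X,X}=1$ (so the Cartan matrix is unipotent lower triangular with respect to any linear extension of the order on $\Lambda(B)$).
   Context: A left regular band is a finite semigroup $B$ with $x^2=x$, $xyx=xy$; $\Lambda(B)=\{Bb\mid b\in B\}$ ordered by inclusion is its support semilattice, and $B_{\ge X}=\{b\mid Bb\supseteq X\}$. $B$ is connected if the order complex (simplicial complex of chains) of each poset $B_{\ge X}$ is connected, where $B$ is ordered by $a\le b$ iff $ba=a$; in this case $\Bbbk B$ is unital. For $X\in\Lambda(B)$, $\Bbbk_X$ denotes $\Bbbk$ with $b\in B$ acting as $1$ if $Bb\supseteq X$ and as $0$ otherwise; these are the simple $\Bbbk B$-modules. The Schützenberger module $\Bbbk L_X$ is the free $\Bbbk$-module on $L_X$ with $a\cdot b=ab$ if $Ba\supseteq X$ and $a\cdot b=0$ otherwise; these are the projective indecomposable $\Bbbk B$-modules ($\Bbbk L_X$ is the projective cover of $\Bbbk_X$). The Cartan invariant $C_{X,Y}$ is the multiplicity of $\Bbbk_X$ as a composition factor of $\Bbbk L_Y$. *)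

(* Defs.v *)
From HB Require Import structures.
From mathcomp Require Import all_boot all_order all_algebra.
From mathcomp Require Import boolp.

Set Implicit Arguments.
Unset Strict Implicit.
Unset Printing Implicit Defensive.

Import Order.TTheory GRing.Theory.

Local Open Scope ring_scope.

(* Fuel-based form of mu(x, x) = 1, mu(x, y) = - \sum_(x <= z < y) mu(x, z) for
   x < y, and mu(x, y) = 0 otherwise; mobius_id, mobius_lt and mobius_nle show
   that the fuel #|P| always suffices. *)
Fixpoint mobius_rec (d : Order.disp_t) (P : finPOrderType d) (n : nat)
    (x y : P) : int :=
  if x == y then 1
  else if n is m.+1 then
    if (x < y)%O then - \sum_(z : P | (x <= z < y)%O) mobius_rec m x z else 0
  else 0.

Definition mobius (d : Order.disp_t) (P : finPOrderType d) (x y : P) : int :=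
  mobius_rec #|P| x y.

Section MobiusTheory.
Context (d : Order.disp_t) (P : finPOrderType d).
Implicit Types x y z : P.

Lemma mobius_rec_fuel m n x y :
  (#|[set z | z < y]%O| <= m)%N -> (#|[set z | z < y]%O| <= n)%N ->
  mobius_rec m x y = mobius_rec n x y.
Proof.
elim: m n y => [|m IHm] [|n] y //=.
- move=> + _; rewrite leqn0 cards_eq0 => /eqP lt0; case: ifP => // _.
  by case: ifP => // xy; have := in_set0 x; rewrite -lt0 inE xy.
- move=> _; rewrite leqn0 cards_eq0 => /eqP lt0; case: ifP => // _.
  by case: ifP => // xy; have := in_set0 x; rewrite -lt0 inE xy.
move=> ym yn; case: ifP => // _; case: ifP => // _; congr (- _).
apply: eq_bigr => z /andP[_ zy].
have zyP : ([set t | t < z] \proper [set t | t < y])%O.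
  apply/properP; split; last by exists z; rewrite !inE ?ltxx.
  by apply/subsetP => t; rewrite !inE => /lt_trans; apply.
by apply: IHm; rewrite -ltnS (leq_trans (proper_card zyP)).
Qed.

Lemma mobius_id x : mobius x x = 1.
Proof. by rewrite /mobius; case: #|P| => [|n] /=; rewrite eqxx. Qed.

Lemma mobius_lt x y : (x < y)%O ->
  mobius x y = - \sum_(z | (x <= z < y)%O) mobius x z.
Proof.
move=> xy; rewrite /mobius; have: (0 < #|P|)%N by apply/card_gt0P; exists x.
case E: #|P| => [//|n] _; rewrite [LHS]/= lt_eqF // xy; congr (- _).
apply: eq_bigr => z /andP[_ zy].
have ltP : (#|[set t | t < z]%O| < #|P|)%N.
  rewrite -cardsT proper_card //; apply/properP; split; first exact: subsetT.
  by exists z; rewrite !inE ?ltxx.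
by apply: mobius_rec_fuel; rewrite E ltnS in ltP => //; apply: leqW.
Qed.

Lemma mobius_nle x y : ~~ (x <= y)%O -> mobius x y = 0.
Proof.
rewrite le_eqVlt negb_or /mobius => /andP[/negPf xy /negPf nxy].
by case: #|P| => [|n] /=; rewrite xy ?nxy.
Qed.

End MobiusTheory.

HB.mixin Record Semigroup_isLeftRegularBand B of Semigroup B & Finite B := {
  lrb_idem : forall x : B, (x * x)%g = x;
  lrb_regular : forall x y : B, (x * y * x)%g = (x * y)%g
}.

#[short(type="leftRegularBandType")]
HB.structure Definition LeftRegularBand :=
  { B of Semigroup_isLeftRegularBand B & Semigroup B & Finite B }.

Section Support.
Context (B : leftRegularBandType).
Implicit Types a b c : B.

Definition left_ideal b : {set B} := [set (a * b)%g | a : B].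

Definition support_pred (X : {set B}) : bool :=
  [exists b, X == left_ideal b].

Record Lambda : Type :=
  MkLambda { lambda_set :> {set B}; _ : support_pred lambda_set }.

HB.instance Definition _ := [isSub for lambda_set].
HB.instance Definition _ := [Finite of Lambda by <:].

Definition Lambda_le : rel Lambda := fun X Y => (X : {set B}) \subset Y.

Fact Lambda_le_refl : reflexive Lambda_le.
Proof. by move=> X; apply: subxx. Qed.

Fact Lambda_le_anti : antisymmetric Lambda_le.
Proof. by move=> X Y XY; apply/val_inj/eqP; rewrite eqEsubset. Qed.

Fact Lambda_le_trans : transitive Lambda_le.
Proof. by move=> Y X Z; apply: subset_trans. Qed.

HB.instance Definition _ := Order.Le_isPOrder.Build (Order.Disp tt tt) Lambda
  Lambda_le_refl Lambda_le_anti Lambda_le_trans.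

Fact left_ideal_support b : support_pred (left_ideal b).
Proof. by apply/existsP; exists b. Qed.

Definition supp b : Lambda := MkLambda (left_ideal_support b).

(* L_X = {b | Bb = X} and B_{>=X} = {b | Bb contains X} *)
Definition Lset (X : Lambda) : {set B} := [set b | supp b == X].

Definition upper (X : Lambda) : {set B} := [set b | (X <= supp b)%O].

Lemma leLambda (X Y : Lambda) : (X <= Y)%O = ((X : {set B}) \subset Y).
Proof. by []. Qed.

Lemma in_left_ideal a b : (a \in left_ideal b) = (a * b == a)%g.
Proof.
apply/imsetP/eqP => [[c _ ->]|ab]; first by rewrite -mulgA lrb_idem.
by exists a.
Qed.

Lemma supp_le a b : (supp a <= supp b)%O = (a * b == a)%g.
Proof.
rewrite leLambda -in_left_ideal; apply/subsetP/idP => [|ab c].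
  by apply; rewrite /= in_left_ideal lrb_idem.
rewrite /= !in_left_ideal => /eqP <-.
by move: ab; rewrite in_left_ideal -mulgA => /eqP ->.
Qed.

Lemma le_supp_mul (X : Lambda) a b :
  (X <= supp (a * b)%g)%O = (X <= supp a)%O && (X <= supp b)%O.
Proof.
case: X => X HX; case/existsP: (HX) => c /eqP Xc.
have -> : MkLambda HX = supp c by apply: val_inj.
rewrite !supp_le; apply/eqP/andP => [cab|[/eqP ca /eqP cb]].
  split; apply/eqP; rewrite -{1}cab -[in LHS]mulgA; last first.
    by rewrite -mulgA lrb_idem.
  by rewrite lrb_regular.
by rewrite mulgA ca cb.
Qed.

End Support.

(* A finite simplicial complex is given by its set of (nonempty) faces; it is
   connected when it is nonempty and any two of its vertices are joined by a
   path of edges. *)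
Definition order_complex (T : finType) (r : rel T) (A : {set T}) :
    {set {set T}} :=
  [set S : {set T} | [&& S != set0, S \subset A &
     [forall x in S, forall y in S, r x y || r y x]]].

Definition connected_complex (T : finType) (D : {set {set T}}) : Prop :=
  D != set0 /\
  forall x y : T, [set x] \in D -> [set y] \in D ->
    connect (fun u v => [set u; v] \in D) x y.

Definition lrb_le (B : leftRegularBandType) : rel B :=
  fun a b => (b * a)%g == a.

Definition connected_lrb (B : leftRegularBandType) : Prop :=
  forall X : Lambda B,
    connected_complex (order_complex (@lrb_le B) (upper X)).

(* A finite-dimensional left module over the semigroup algebra kB, given by the
   action of the basis B of kB. *)
Record kBmodule (B : leftRegularBandType) (k : fieldType) := KBModule {
  carrier :> vectType k;
  act : B -> 'End(carrier);
  actM : forall a b : B, act (a * b)%g = (act a \o act b)%VF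
}.

Section CompositionFactors.
Context (B : leftRegularBandType) (k : fieldType).
Implicit Types M S : kBmodule B k.

Definition submodule M (U : {vspace M}) : Prop :=
  forall b : B, (act M b @: U <= U)%VS.

Definition maximal_submodule M (W U : {vspace M}) : Prop :=
  [/\ submodule W, submodule U, (W <= U)%VS, W <> U &
      forall V : {vspace M}, submodule V -> (W <= V)%VS -> (V <= U)%VS ->
        V = W \/ V = U].

(* The chain 0 = F 0 < F 1 < ... < F n = M *)
Definition composition_series M (n : nat) (F : nat -> {vspace M}) : Prop :=
  [/\ F 0%N = 0%VS, F n = fullv &
      forall i, (i < n)%N -> maximal_submodule (F i) (F i.+1)].

(* U / W is isomorphic to S: there is a surjective module morphism from U to S
   with kernel W (its values outside U are irrelevant). *)
Definition factor_isom M (W U : {vspace M}) S : Prop :=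
  exists f : 'Hom(M, S),
    [/\ forall (b : B) (u : M), u \in U -> f (act M b u) = act S b (f u),
        (f @: U)%VS = fullv & (U :&: lker f)%VS = W].

Lemma composition_series_exists M :
  exists s : nat * (nat -> {vspace M}), composition_series s.1 s.2.
Proof.
suff ext n (U : {vspace M}) : (\dim U <= n)%N -> submodule U ->
    exists m (F : nat -> {vspace M}), [/\ F 0%N = 0%VS, F m = U &
      forall i, (i < m)%N -> maximal_submodule (F i) (F i.+1)].
  have [|m [F HF]] := ext _ fullv (leqnn _); first by move=> b; apply: subvf.
  by exists (m, F).
elim: n U => [|n IHn] U.
  rewrite leqn0 dimv_eq0 => /eqP -> _.
  by exists 0%N, (fun=> 0%VS).
move=> Un Usub; have [->|U0] := eqVneq U 0%VS.
  by exists 0%N, (fun=> 0%VS).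
pose Q (j : nat) := `[< exists W : {vspace M},
  [/\ submodule W, (W <= U)%VS, W <> U & \dim W = j] >].
have Q0 : exists j, Q j.
  exists 0%N; apply/asboolP; exists 0%VS.
  split; [|exact: sub0v|by apply/eqP; rewrite eq_sym|exact: dimv0].
  by move=> b; rewrite limg0 subvv.
have Qb j : Q j -> (j <= \dim U)%N.
  by move=> /asboolP[W [_ WU _ <-]]; apply: dimvS.
case: (ex_maxnP Q0 Qb) => j /asboolP[W [Wsub WU WnU Wj]] jmax.
have WltU : (\dim W < \dim U)%N.
  rewrite ltn_neqAle dimvS // andbT; apply/eqP => E; apply: WnU.
  by apply/eqP; rewrite eqEdim WU E leqnn.
have [|m [F [F0 Fm Fi]]] := IHn W _ Wsub.
  by rewrite -ltnS; apply: leq_trans Un.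
exists m.+1, (fun i => if (i <= m)%N then F i else U); split => //.
  by rewrite ltnn.
move=> i; rewrite ltnS => im; rewrite im; case: ltnP => [/Fi //|mi].
have -> : i = m by apply/eqP; rewrite eqn_leq im.
rewrite Fm; split => // V Vsub WV VU.
have [->|VnU] := pselect (V = U); [by right | left].
have QV : Q (\dim V) by apply/asboolP; exists V.
have := jmax _ QV; rewrite -Wj => VW.
by apply/esym/eqP; rewrite eqEdim WV VW.
Qed.

(* Computed in some composition series; by the Jordan-Hölder theorem the choice
   does not matter. *)
Definition factor_multiplicity M S : nat :=
  let s := sval (cid (composition_series_exists M)) in
  #|[set i : 'I_s.1 | `[< factor_isom (s.2 i) (s.2 i.+1) S >]]|.

End CompositionFactors.

Section CartanInvariants.
Context (B : leftRegularBandType) (k : fieldType).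
Implicit Types X Y : Lambda B.
Local Notation LsetT X := {b : B | b \in Lset X}.
Local Notation kL X := {ffun LsetT X -> k^o}.

Definition simple_act X (b : B) : 'End(k^o) :=
  if (X <= supp b)%O then \1%VF else 0.

Fact simple_actM X a b :
  simple_act X (a * b)%g = (simple_act X a \o simple_act X b)%VF.
Proof.
rewrite /simple_act le_supp_mul; case: (X <= supp a)%O => /=; last first.
  by rewrite comp_lfun0l.
by rewrite comp_lfun1l.
Qed.

Definition simple_module X : kBmodule B k := KBModule (simple_actM X).

(* An element of kL_X is the function of its coordinates in the basis L_X. *)
Definition schutz_fun X (a : B) (f : kL X) : kL X :=
  [ffun c => if (X <= supp a)%O
             then \sum_(b | (a * val b)%g == val c) f b else 0].

Fact schutz_fun_linear X a : linear (@schutz_fun X a).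
Proof.
move=> t f g; apply/ffunP => c; rewrite !ffunE.
case: ifP => _; last by rewrite scaler0 addr0.
by rewrite scaler_sumr -big_split; apply: eq_bigr => b _; rewrite !ffunE.
Qed.

HB.instance Definition _ X a :=
  GRing.isLinear.Build k (kL X) (kL X) *:%R (@schutz_fun X a)
    (@schutz_fun_linear X a).

Definition schutz_act X (a : B) : 'End(kL X) := linfun (@schutz_fun X a).

Lemma mul_Lset X a b :
  (X <= supp a)%O -> b \in Lset X -> (a * b)%g \in Lset X.
Proof.
rewrite !inE => + /eqP bX; rewrite -bX eq_le le_supp_mul => ->.
by rewrite lexx !andbT supp_le -mulgA lrb_idem.
Qed.

Fact schutz_actM X a b :
  schutz_act X (a * b)%g = (schutz_act X a \o schutz_act X b)%VF.
Proof.
apply/lfunP => f; rewrite comp_lfunE !lfunE /=.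
apply/ffunP => c; rewrite !ffunE le_supp_mul.
case: ifP => [/andP[Xa Xb]|]; last first.
  move=> /negbT; rewrite negb_and; case: (X <= supp a)%O => //= /negPf Xb.
  by rewrite big1 // => e _; rewrite ffunE Xb.
rewrite Xa; under [RHS]eq_bigr => e _ do rewrite ffunE Xb.
rewrite (exchange_big_dep predT) //= big_mkcond /=; apply: eq_bigr => x _.
have bxL : (b * val x)%g \in Lset X by apply: mul_Lset (valP x).
case: ifP => abx.
  rewrite (big_pred1 (Sub (b * val x)%g bxL : LsetT X)) // => e.
  rewrite /= [in RHS]eq_sym; apply/andP/eqP => [[_ /eqP ex]|<-].
    exact: val_inj.
  by rewrite /= mulgA.
rewrite big_pred0 // => e; apply/negbTE/negP => /andP[/eqP ec /eqP bx].
by move: abx; rewrite -mulgA bx ec eqxx.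
Qed.

Definition schutz_module X : kBmodule B k := KBModule (schutz_actM X).

Definition schutz_basis X (b : LsetT X) : schutz_module X :=
  [ffun c => (c == b)%:R].

Lemma schutz_act_basis X a (b c : LsetT X) :
  (X <= supp a)%O -> (a * val b)%g = val c ->
  act (schutz_module X) a (schutz_basis b) = schutz_basis c.
Proof.
move=> Xa abc; rewrite lfunE /=; apply/ffunP => e; rewrite !ffunE Xa.
rewrite big_mkcond (bigD1 b) //= big1 ?addr0 => [|x /negPf xb].
  by rewrite ffunE eqxx abc -val_eqE eq_sym; case: eqP.
by rewrite ffunE xb if_same.
Qed.

Lemma schutz_act_basis0 X a (b : LsetT X) :
  ~~ (X <= supp a)%O -> act (schutz_module X) a (schutz_basis b) = 0.
Proof.
by move=> /negPf Xa; rewrite lfunE; apply/ffunP => c; rewrite !ffunE Xa.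
Qed.

Definition cartan X Y : nat :=
  factor_multiplicity (schutz_module Y) (simple_module X).

End CartanInvariants.

(* Main.v *)
(* The rank of e_Z is additive along a composition series. A composition factor
   is either some k_X, on which e_Z has rank 1 or 0 according as X <= Z or not,
   or killed by B, and then does not contribute to any rank. Hence
   dim (e_Z kL_Y) = \sum_(X <= Z) C_(X, Y); the left side is |e_Z B :&: L_Y|,
   and Möbius inversion gives the formula. *)

Require Import Defs.
From HB Require Import structures.
From mathcomp Require Import all_boot all_order all_algebra.
From mathcomp Require Import boolp.

Set Implicit Arguments.
Unset Strict Implicit.
Unset Printing Implicit Defensive.

Import Order.TTheory GRing.Theory.

Local Open Scope ring_scope.

(** * Möbius inversion over a finite poset *)

Section MobiusInversion.
Context (d : Order.disp_t) (P : finPOrderType d).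
Implicit Types x y z : P.

(** For [x < y] the recursion makes the term at [z = y] cancel all the others, because the terms
    with [z] not above [x] vanish. *)
Lemma sum_mobius_left x y :
  \sum_(z | (z <= y)%O) mobius x z = (x == y)%:R.
Proof.
have [<-|xy] := eqVneq x y.
  rewrite (bigD1 x) //= mobius_id big1 ?addr0 // => z /andP[zx zNx].
  by apply: mobius_nle; apply: contra zNx => xz; rewrite eq_le zx.
have [xley|xNy] := boolP (x <= y)%O; last first.
  rewrite big1 // => z zy; apply: mobius_nle.
  by apply: contra xNy => /le_trans; apply.
have xlty : (x < y)%O by rewrite lt_neqAle xy.
rewrite (bigD1 y) //= (mobius_lt xlty) addrC; apply/eqP; rewrite subr_eq0.
apply/eqP; rewrite big_mkcond [RHS]big_mkcond; apply: eq_bigr => z _ /=.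
rewrite [in RHS]lt_neqAle (andbC (z != y)).
case: (_ && _); last by rewrite andbF.
by rewrite andbT; case: ifP => // /negbT/mobius_nle.
Qed.

(* A left inverse of the zeta matrix is also a right inverse. *)
Lemma sum_mobius_right x y :
  \sum_(z | (x <= z)%O) mobius z y = (x == y)%:R.
Proof.
pose M : 'M[int]_#|P| := \matrix_(i, j) mobius (enum_val i) (enum_val j).
pose Z : 'M[int]_#|P| := \matrix_(i, j) (enum_val i <= enum_val j)%O%:R.
have sumE (F : P -> int) : \sum_(i < #|P|) F (enum_val i) = \sum_z F z.
  rewrite (reindex enum_rank) /=; last exact/onW_bij/enum_rank_bij.
  by apply: eq_bigr => z _; rewrite enum_rankK.
have /mulmx1C/matrixP/(_ (enum_rank x) (enum_rank y)) : M *m Z = 1%:M.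
  apply/matrixP => i j; rewrite !mxE.
  rewrite -(inj_eq enum_val_inj) -sum_mobius_left [RHS]big_mkcond -sumE.
  by apply: eq_bigr => l _; rewrite !mxE mulr_natr mulrb.
rewrite !mxE (inj_eq enum_rank_inj) => <-.
rewrite [LHS]big_mkcond -sumE; apply: eq_bigr => l _.
by rewrite !mxE !enum_rankK mulr_natl mulrb.
Qed.

Lemma mobius_inversion (f g : P -> int) :
  (forall z, g z = \sum_(x | (x <= z)%O) f x) ->
  forall y, f y = \sum_(z | (z <= y)%O) g z * mobius z y.
Proof.
move=> gE y; transitivity (\sum_z g z * mobius z y); last first.
  rewrite [RHS]big_mkcond; apply: eq_bigr => z _.
  by case: ifP => // /negbT/mobius_nle ->; rewrite mulr0.
under eq_bigr => z _ do rewrite gE mulr_suml.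
rewrite (exchange_big_dep predT) //=.
under eq_bigr => x _ do rewrite -mulr_sumr sum_mobius_right.
rewrite (bigD1 y) //= eqxx mulr1 big1 ?addr0 // => x /negPf ->.
by rewrite mulr0.
Qed.

End MobiusInversion.

(** * Simple factors of a module and the rank of a semigroup element *)

Section CompositionFactors.
Context (B : leftRegularBandType) (k : fieldType).
Implicit Types (M : kBmodule B k) (X : Lambda B) (b c : B).

Lemma Lambda_supp X : exists b, X = supp b.
Proof.
case: X => A HA; case/existsP: (HA) => b /eqP Ab.
by exists b; apply: val_inj.
Qed.

Lemma act_mul M b c u : act M (b * c)%g u = act M b (act M c u).
Proof. by rewrite actM comp_lfunE. Qed.

Lemma submodule_act M (U : {vspace M}) b u :
  submodule U -> u \in U -> act M b u \in U.
Proof. by move=> Usub uU; apply: (subvP (Usub b)); apply: memv_img. Qed.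

(* A factor on which B does not act by zero is k_X, where X is minimal among
   the supports of the elements acting nontrivially. *)
Lemma maximal_submodule_character M (W U : {vspace M}) :
  maximal_submodule W U ->
  (forall b u, u \in U -> act M b u \in W) \/
  exists X, forall b u, u \in U ->
    act M b u - (if (X <= supp b)%O then u else 0) \in W.
Proof.
move=> [Wsub Usub WU WnU Wmax].
pose nz b := ~~ (act M b @: U <= W)%VS.
have zero b u : ~~ nz b -> u \in U -> act M b u \in W.
  by move=> /negPn bUW uU; apply: (subvP bUW); apply: memv_img.
have [/existsP[b0 nzb0]|nex] := boolP [exists b, nz b]; last first.
  left=> b u; apply: zero; apply: contra nex => nzb.
  by apply/existsP; exists b.
right; case: (arg_minnP (fun b => #|left_ideal b|) nzb0) => b nzb bmin.
(* Here [b * c] has strictly smaller support than [b], so it acts by zero on [U / W], by the choice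
   of [b]. *)
have bW c u : ~~ (supp b <= supp c)%O -> u \in U -> act M b (act M c u) \in W.
  move=> bNc uU; rewrite -act_mul; apply: zero => //.
  apply/negP => /bmin; rewrite leqNgt => /negP; apply; apply: proper_card.
  have : (supp (b * c)%g < supp b)%O.
    by rewrite lt_leAnge supp_le le_supp_mul (negPf bNc) andbF lrb_regular eqxx.
  by rewrite lt_leAnge properE.
(* [V / W] is the kernel of [b] on [U / W]. It is a proper submodule, hence zero, so membership in
   [W] can be tested after applying [b]. *)
pose V := (U :&: (act M b @^-1: W))%VS.
have memV u : (u \in V) = (u \in U) && (act M b u \in W).
  by rewrite memv_cap -memv_preim.
have VW : V = W.
  have [|||//|VU] := Wmax V.
  - move=> c; apply/subvP => _ /memv_imgP[u + ->]; rewrite !memV.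
    move=> /andP[uU buW]; rewrite (submodule_act c Usub uU) /=.
    have [|/bW bcW] := boolP (supp b <= supp c)%O; last exact: bcW.
    by rewrite supp_le -act_mul => /eqP ->.
  - apply/subvP => u uW; rewrite memV (subvP WU) //=.
    exact: submodule_act.
  - exact: capvSl.
  - case/negP: nzb; apply/subvP => _ /memv_imgP[u + ->].
    by rewrite -VU memV => /andP[].
exists (supp b) => c u uU; rewrite -VW memV.
have [|/bW bcW] := ifPn; last by rewrite subr0 (submodule_act c Usub uU) bcW.
rewrite supp_le => /eqP bc.
rewrite rpredB ?(submodule_act c Usub uU) //= linearB /= -act_mul bc subrr.
exact: mem0v.
Qed.

(** Every element of [B] acts on [U / W] as the scalar 0 or 1, so [W] together with any vector of
    [U] outside [W] spans a submodule, which by maximality is [U]. *)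
Lemma maximal_submodule_line M (W U : {vspace M}) X :
  maximal_submodule W U ->
  (forall b u, u \in U ->
    act M b u - (if (X <= supp b)%O then u else 0) \in W) ->
  exists2 u, u \notin W & U = (W + <[u]>)%VS.
Proof.
move=> [Wsub Usub WU WnU Wmax] UX.
have /subvPn[u uU uW] : ~~ (U <= W)%VS.
  by apply/negP => UW; apply: WnU; apply: subv_anti; rewrite WU.
have UWu : (W + <[u]> <= U)%VS by rewrite subv_add WU -memvE.
exists u => //.
have [|||E|//] := Wmax (W + <[u]>)%VS.
- move=> c; rewrite limgD subv_add (subv_trans (Wsub c)) ?addvSl //=.
  rewrite limg_line -memvE -(subrK (if (X <= supp c)%O then u else 0) (act M c u)).
  apply: memv_add; first exact: UX.
  by case: ifP => _; rewrite ?mem0v ?memv_line.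
- exact: addvSl.
- exact: UWu.
- by case/negP: uW; rewrite -E memvE addvSr.
Qed.

(** The functional is the projection onto the line of [u] along [W], followed by the coordinate on
    that line. It provides the morphism that [factor_isom] asks for. *)
Lemma line_quotient_coord M (W : {vspace M}) u : u \notin W ->
  exists f : 'Hom(M, k^o), f u = 1 /\ forall w, w \in W -> f w = 0.
Proof.
move=> uW.
have u0 : u != 0 by apply: contraNneq uW => ->; exact: mem0v.
have fr : free [tuple u] by rewrite seq1_free.
have dir : (<[u]> :&: W = 0)%VS.
  apply/eqP; rewrite -subv0; apply/subvP => v; rewrite memv_cap => /andP[].
  case/vlineP => t -> tuW; have [->|t0] := eqVneq t 0.
    by rewrite scale0r mem0v.
  by case/negP: uW; rewrite -(scalerK t0 u) memvZ.
pose f : 'Hom(M, k^o) :=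
  (linfun (coord [tuple u] ord0 : M -> k^o) \o daddv_pi <[u]> W)%VF.
exists f; split=> [|w wW]; rewrite comp_lfunE lfunE /=.
  by rewrite daddv_pi_id ?memv_line // (coord_free ord0 ord0 fr).
suff -> : daddv_pi <[u]> W w = 0 by rewrite linear0.
(* The projections of [w] to the line and to [W] add up to [w], and the second one is already
   [w]. *)
have := @daddv_pi_add _ _ <[u]>%VS W w dir.
rewrite (@daddv_pi_id _ _ W <[u]>) //; last by rewrite capvC.
move=> /(_ (subvP (addvSr _ _) _ wW)) /eqP.
by rewrite -subr_eq0 addrK => /eqP.
Qed.

Lemma factor_isom_simple M (W U : {vspace M}) X :
  maximal_submodule W U ->
  (forall b u, u \in U ->
    act M b u - (if (X <= supp b)%O then u else 0) \in W) ->
  forall X', factor_isom W U (simple_module k X') <-> X' = X.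
Proof.
move=> WUmax UX; have [u uW UE] := maximal_submodule_line WUmax UX.
have [Wsub Usub WU WnU Wmax] := WUmax.
have uU : u \in U by rewrite UE memvE addvSr.
move=> X'; split=> [[f [fact_ _ fW]]|->].
  have f0 w : w \in W -> f w = 0.
    by rewrite -fW memv_cap memv_ker => /andP[_ /eqP].
  have fu : f u != 0.
    by apply: contraNneq uW => fu; rewrite -fW memv_cap uU memv_ker fu eqxx.
  (* Both characters are read off from the action of [b] on the nonzero vector [f u]. Evaluating
     them at elements of support [X] and [X'] then gives both inequalities. *)
  have XX' b : (X' <= supp b)%O = (X <= supp b)%O.
    have /f0/eqP := UX b u uU; rewrite linearB /= fact_ // /= /simple_act.
    rewrite subr_eq0; case: ifP => _; case: ifP => _ //; rewrite lfunE /= ?linear0.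
      by move=> /eqP E; rewrite E eqxx in fu.
    by rewrite eq_sym (negPf fu).
  apply: le_anti; have [b Xb] := Lambda_supp X.
  have [b' Xb'] := Lambda_supp X'.
  by rewrite {1}Xb XX' -Xb lexx Xb' -XX' -Xb' lexx.
have [f [fu fW]] := line_quotient_coord uW.
exists f; split.
- move=> b v vU; have /fW/eqP := UX b v vU.
  rewrite linearB subr_eq0 => /eqP -> /=; rewrite /simple_act.
  by case: ifP => _; rewrite lfunE //= linear0.
- apply: subv_anti; rewrite subvf /=; apply/subvP => t _.
  apply/memv_imgP; exists (t *: u); first exact: memvZ.
  by rewrite linearZ /= fu -[LHS]mulr1.
- apply: subv_anti; apply/andP; split; apply/subvP => v; rewrite memv_cap memv_ker.
    rewrite UE => /andP[/memv_addP[w wW [_ /vlineP[t ->] ->]]].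
    rewrite linearD linearZ /= fu fW // add0r => /eqP.
    by rewrite -[_ *: 1]/(t * 1) mulr1 => ->; rewrite scale0r addr0.
  by move=> vW; rewrite (subvP WU) //= fW.
Qed.

(** The sum is 1 if the factor is some simple module on which [b] acts as the identity, and 0
    otherwise. In the first case [U] is [W] plus a line, whose image under [b] is a line meeting [W]
    only in 0. *)
Lemma dim_act_maximal M (W U : {vspace M}) b :
  maximal_submodule W U ->
  \dim (act M b @: U) = (\dim (act M b @: W) +
    \sum_(X : Lambda B | (X <= supp b)%O)
      `[< factor_isom W U (simple_module k X) >])%N.
Proof.
move=> WUmax; have [Wsub Usub WU WnU Wmax] := WUmax.
(* Idempotence: if [b] maps [U] into [W], then [b U = b (b U)] lies in [b W]. *)
have dimE : (forall u, u \in U -> act M b u \in W) ->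
    \dim (act M b @: U) = \dim (act M b @: W).
  move=> UW; congr (\dim _); apply: subv_anti; apply/andP.
  split; last exact: limgS.
  apply/subvP => _ /memv_imgP[u /UW uU ->].
  by rewrite -{1}[b]lrb_idem act_mul memv_img.
have [UW|[X UX]] := maximal_submodule_character WUmax.
  rewrite dimE; last by move=> u; exact: UW.
  (* A factor killed by [B] is no simple module of index [X], since an element of support [X] acts
     as the identity there. *)
  rewrite big1 ?addn0 // => X _; case: asboolP => // -[f [fact_ fU fW]].
  have [c Xc] := Lambda_supp X.
  have : (fullv : {vspace k^o}) == 0%VS.
    rewrite -subv0 -fU; apply/subvP => _ /memv_imgP[u uU ->].
    have := fact_ c u uU; rewrite /= /simple_act Xc lexx lfunE /= => <-.
    have := UW c u uU; rewrite -fW memv_cap memv_ker => /andP[_ /eqP ->].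
    exact: mem0v.
  by rewrite -dimv_eq0 dimvf.
have isoE := factor_isom_simple WUmax UX.
have sumE : (\sum_(X' : Lambda B | (X' <= supp b)%O)
    `[< factor_isom W U (simple_module k X') >] = (X <= supp b)%O)%N.
  rewrite big_mkcond (bigD1 X) //= big1 => [|X' /eqP X'X].
    by rewrite addn0; case: ifP => // _; case: asboolP => // /isoE.
  by case: ifP => // _; case: asboolP => // /isoE.
rewrite sumE; have [Xb|XNb] := boolP (X <= supp b)%O; last first.
  rewrite addn0; apply: dimE => u uU.
  by have := UX b u uU; rewrite (negPf XNb) subr0.
have [u uW UE] := maximal_submodule_line WUmax UX.
have buW : act M b u \notin W.
  apply: contra uW => buW; have := UX b u.
  rewrite Xb {1}UE memvE addvSr => /(_ isT) /(rpredB buW).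
  by rewrite opprB addrC subrK.
rewrite UE limgD limg_line dimv_disjoint_sum.
  by rewrite dim_vline; case: eqP buW => // ->; rewrite mem0v.
apply/eqP; rewrite -subv0; apply/subvP => v; rewrite memv_cap => /andP[vW].
case/vlineP => t vE; have [t0|t0] := eqVneq t 0.
  by rewrite vE t0 scale0r mem0v.
case/negP: buW; rewrite -(scalerK t0 (act M b u)) -vE memvZ //.
by apply: (subvP (Wsub b)).
Qed.

Lemma dim_act_multiplicity M b :
  \dim (act M b @: fullv) = (\sum_(X : Lambda B | (X <= supp b)%O)
    factor_multiplicity M (simple_module k X))%N.
Proof.
rewrite /factor_multiplicity; case: (cid _) => -[n F] /= [F0 Fn Fmax].
have dimF m : (m <= n)%N -> \dim (act M b @: F m) =
    (\sum_(i < m) \sum_(X : Lambda B | (X <= supp b)%O)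
       `[< factor_isom (F i) (F i.+1) (simple_module k X) >])%N.
  elim: m => [|m IHm] mn; first by rewrite F0 limg0 dimv0 big_ord0.
  by rewrite big_ord_recr -IHm ?(ltnW mn) //= -(dim_act_maximal b (Fmax m mn)).
rewrite -Fn dimF // exchange_big; apply: eq_bigr => X _ /=.
by rewrite cardsE -sum1_card [RHS]big_mkcond.
Qed.

End CompositionFactors.

(** * Ranks on Schützenberger modules *)

Section Schutzenberger.
Context (B : leftRegularBandType) (k : fieldType).
Implicit Types (X Y Z : Lambda B) (a b : B).

Lemma free_schutz_basis Y (s : seq {b : B | b \in Lset Y}) :
  uniq s -> free [seq schutz_basis k c | c <- s].
Proof.
elim: s => [_|c s IHs /= /andP[cs us]]; first exact: nil_free.
rewrite free_cons IHs // andbT; apply/negP => cspan.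
have [f fc /subvP/(_ _ cspan)] : exists2 f : 'Hom(schutz_module k Y, k^o),
    f (schutz_basis k c) = 1 & (<<[seq schutz_basis k c | c <- s]>> <= lker f)%VS.
  (* Evaluation at [c] is 1 on the basis vector of [c] and kills the other basis vectors. *)
  pose ev (f : schutz_module k Y) : k^o := (f : {ffun _ -> _}) c.
  have ev_lin : linear ev by move=> t f g; rewrite /ev !ffunE.
  pose evL := GRing.isLinear.Build k (schutz_module k Y) k^o _ ev ev_lin.
  pose evl : {linear schutz_module k Y -> k^o} := HB.pack ev evL.
  exists (linfun evl); first by rewrite lfunE /= /ev ffunE eqxx.
  apply/span_subvP => _ /mapP[x xs ->]; rewrite memv_ker lfunE /= /ev ffunE.
  by case: (c =P x) => [cx|_]; rewrite ?eqxx //; rewrite cx xs in cs.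
by rewrite memv_ker fc oner_eq0.
Qed.

(** By idempotence, [b] lies in [aB] exactly when [a] fixes it; regularity then gives [b * a = b],
    that is, [supp b <= supp a]. *)
Lemma in_mulset_Lset Y a b :
  (b \in [set (a * x)%g | x : B] :&: Lset Y) =
  [&& (a * b == b)%g, (Y <= supp a)%O & b \in Lset Y].
Proof.
rewrite in_setI; apply/andP/and3P => [[/imsetP[x _ bE] bY]|[/eqP ab _ bY]].
  split=> //; first by rewrite bE mulgA lrb_idem.
  move: bY; rewrite inE => /eqP <-.
  by rewrite bE supp_le lrb_regular.
by split=> //; apply/imsetP; exists b.
Qed.

(** If [Y <= supp a], then [a] maps every basis vector to one that [a] fixes, so the fixed basis
    vectors form a basis of the image. Otherwise both sides are 0. *)
Lemma dim_act_schutz Y a :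
  \dim (act (schutz_module k Y) a @: fullv) =
  #|[set (a * b)%g | b : B] :&: Lset Y|.
Proof.
pose T := {b : B | b \in Lset Y}.
have [Ya|YNa] := boolP (Y <= supp a)%O; last first.
  rewrite (_ : _ :&: _ = set0) ?cards0; last first.
    by apply/setP => b; rewrite in_mulset_Lset (negPf YNa) andbF inE.
  apply/eqP; rewrite dimv_eq0 -subv0; apply/subvP => _ /memv_imgP[f _ ->].
  rewrite memv0 lfunE /=; apply/eqP/ffunP => c.
  by rewrite !ffunE (negPf YNa).
pose S := [set c : T | (a * val c)%g == val c].
pose s := [seq schutz_basis k c | c <- enum S].
have -> : (act (schutz_module k Y) a @: fullv)%VS = <<s>>%VS.
  apply: subv_anti; apply/andP; split.
    apply/subvP => _ /memv_imgP[f _ ->].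
    have -> : act (schutz_module k Y) a f =
        \sum_c (act (schutz_module k Y) a f : {ffun T -> k^o}) c
                 *: schutz_basis k c.
      apply/ffunP => c; rewrite sum_ffunE (bigD1 c) //= big1 => [|x xc].
        by rewrite addr0 !ffunE eqxx /GRing.scale /= mulr1.
      by rewrite !ffunE eq_sym (negPf xc) scaler0.
    apply: rpred_sum => c _; have [cS|cNS] := boolP (c \in S).
      by apply/memvZ/memv_span/map_f; rewrite mem_enum.
    (* A coordinate [c] not fixed by [a] is not of the form [a * x], so its defining sum is
       empty. *)
    rewrite lfunE /= ffunE Ya big_pred0 ?scale0r ?mem0v // => x.
    apply: contraNF cNS => /eqP ax; rewrite inE -ax mulgA lrb_idem.
    exact: eqxx.
  apply/span_subvP => _ /mapP[c + ->]; rewrite mem_enum inE => /eqP ac.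
  by rewrite -(schutz_act_basis k Ya ac) memv_img ?memvf.
have /eqP -> : free s by apply: free_schutz_basis; exact: enum_uniq.
rewrite size_map -cardE -(card_imset _ val_inj); apply: eq_card => b.
rewrite in_mulset_Lset Ya /=; apply/imsetP/andP => [[c + ->]|[ab bY]].
  by rewrite inE => ac; split=> //; exact: valP.
by exists (Sub b bY); rewrite ?inE.
Qed.

End Schutzenberger.

(** * The Cartan invariants and their triangularity *)

Theorem theorem4p17 (B : leftRegularBandType) (k : fieldType)
    (hB : connected_lrb B)
    (e : Lambda B -> B) (he : forall X : Lambda B, supp (e X) = X) :
  [/\ (forall X Y : Lambda B,
         (cartan k X Y)%:Z =
         \sum_(Z : Lambda B | (Z <= X)%O)
            #|[set (e Z * b)%g | b : B] :&: Lset Y|%:Z * mobius Z X),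
      (forall X Y : Lambda B, ~~ (Y <= X)%O -> cartan k X Y = 0%N),
      (forall X : Lambda B, cartan k X X = 1%N) &
      (forall (n : nat) (l : 'I_n -> Lambda B), bijective l ->
         (forall i j : 'I_n, (l i <= l j)%O -> (i <= j)%N) ->
         let C : 'M[int]_n := \matrix_(i, j) (cartan k (l i) (l j))%:Z in
         is_trig_mx C /\ (forall i : 'I_n, C i i = 1))].
Proof.
have cartanE X Y : (cartan k X Y)%:Z = \sum_(Z : Lambda B | (Z <= X)%O)
    #|[set (e Z * b)%g | b : B] :&: Lset Y|%:Z * mobius Z X.
  apply: (mobius_inversion (f := fun X => (cartan k X Y)%:Z)
    (g := fun Z => #|[set (e Z * b)%g | b : B] :&: Lset Y|%:Z)) => Z.
  by rewrite -(dim_act_schutz k) dim_act_multiplicity he (big_morph Posz PoszD (erefl _)).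
have card0 (Z Y : Lambda B) : ~~ (Y <= Z)%O ->
    #|[set (e Z * b)%g | b : B] :&: Lset Y| = 0%N.
  move=> YNZ; apply/eqP; rewrite cards_eq0; apply/eqP/setP => b.
  by rewrite in_mulset_Lset he (negPf YNZ) andbF inE.
have cartan0 (X Y : Lambda B) : ~~ (Y <= X)%O -> cartan k X Y = 0%N.
  move=> YNX; suff [] : (cartan k X Y)%:Z = 0 by [].
  rewrite cartanE big1 // => Z ZX.
  by rewrite card0 ?mul0r //; apply: contra YNX => /le_trans; apply.
have cartan1 (X : Lambda B) : cartan k X X = 1%N.
  suff [] : (cartan k X X)%:Z = 1 by [].
  (* Only [Z = X] contributes: for [Z < X] the set counted is empty. *)
  rewrite cartanE (bigD1 X) //= big1 ?addr0; last first.
    move=> Z /andP[ZX ZNX]; rewrite card0 ?mul0r //.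
    by apply: contra ZNX => XZ; rewrite eq_le ZX.
  (* An element [b] of support [X] satisfies [e X * b = e X], so it is fixed by [e X] only if it
     equals [e X]. *)
  rewrite mobius_id mulr1 (_ : _ :&: _ = [set e X]) ?cards1 //.
  apply/setP => b; rewrite in_mulset_Lset he lexx !inE /=.
  apply/andP/eqP => [[/eqP eb /eqP bX]|->]; last by rewrite he lrb_idem !eqxx.
  by apply/eqP; rewrite -{1}eb -supp_le he bX.
split=> // n l _ lmono C; split; last by move=> i; rewrite mxE cartan1.
apply/is_trig_mxP => i j ij; rewrite mxE cartan0 //.
by apply: contraTN ij => /lmono; rewrite -leqNgt.
Qed.
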